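(* Let $X\in\{\,\text{(empty)},\mathrm N,\mathrm T,\mathrm W,\mathrm C,\mathrm A,\mathrm{NA}\}$, and let $\mathsf{G.N}X$ and $\mathsf{H.N}X$ be the corresponding sequent and hypersequent calculi. For every formula $A$, if the sequent $\Rightarrow A$ is derivable in $\mathsf{G.N}X$, then the hypersequent $\Rightarrow A$ is derivable in $\mathsf{H.N}X$.
   Context: Language: formulas $A ::= p \mid \bot \mid A\to A \mid A \preccurlyeq A$ over countably many atoms; $\top$ defined as usual. Sequent calculi. Sequents $\Gamma\Rightarrow\Delta$: $\Gamma,\Delta$ finite multisets of formulas. Rules (write $\Sigma^{\preccurlyeq}$ for $C_1\preccurlyeq D_1,\dots,C_n\preccurlyeq D_n$; $\Gamma^{\preccurlyeq}$, $\Delta^{\preccurlyeq}$ for the $\preccurlyeq$-formulas in $\Gamma$, $\Delta$): init: $\Gamma,p\Rightarrow p,\Delta$; $\bot_L$: $\Gamma,\bot\Rightarrow\Delta$; $\to_L$: from $\Gamma\Rightarrow A,\Delta$ and $\Gamma,B\Rightarrow\Delta$ infer $\Gamma,A\to B\Rightarrow\Delta$; $\to_R$: from $\Gamma,A\Rightarrow B,\Delta$ infer $\Gamma\Rightarrow A\to B,\Delta$. $\mathrm{CP}_n$: from $\{C_k\Rightarrow A,D_1,\dots,D_{k-1}\}_{1\le k\le n}$ and $B\Rightarrow A,D_1,\dots,D_n$ infer $\Gamma,\Sigma^{\preccurlyeq}\Rightarrow A\preccurlyeq B,\Delta$. $\mathrm N_n$: from $\{C_k\Rightarrow D_1,\dots,D_{k-1}\}_{k\le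 n}$ and $\Rightarrow D_1,\dots,D_n$ infer $\Gamma,\Sigma^{\preccurlyeq}\Rightarrow\Delta$. $\mathrm T_n$: from $\{C_k\Rightarrow D_1,\dots,D_{k-1}\}_{k\le n}$ and $\Gamma,\Sigma^{\preccurlyeq}\Rightarrow D_1,\dots,D_n,\Delta$ infer $\Gamma,\Sigma^{\preccurlyeq}\Rightarrow\Delta$. $\mathrm W_n$: from $\{C_k\Rightarrow A,D_1,\dots,D_{k-1}\}_{k\le n}$ and $\Gamma,\Sigma^{\preccurlyeq}\Rightarrow A,A\preccurlyeq B,D_1,\dots,D_n,\Delta$ infer $\Gamma,\Sigma^{\preccurlyeq}\Rightarrow A\preccurlyeq B,\Delta$. $\mathrm W_0$: from $\Gamma\Rightarrow A\preccurlyeq B,A,\Delta$ infer $\Gamma\Rightarrow A\preccurlyeq B,\Delta$. $\mathrm C_0$: from $\Gamma,A\preccurlyeq B,A\Rightarrow\Delta$ and $\Gamma,A\preccurlyeq B\Rightarrow B,\Delta$ infer $\Gamma,A\preccurlyeq B\Rightarrow\Delta$. $\mathrm A_n$: from $\{\Gamma^{\preccurlyeq},\Sigma^{\preccurlyeq},C_k\Rightarrow A\preccurlyeq B,A,D_1,\dots,D_{k-1},\Delta^{\preccurlyeq}\}_{k\le n}$ and $\Gamma^{\preccurlyeq},\Sigma^{\preccurlyeq},B\Rightarrow A\preccurlyeq B,A,D_1,\dots,D_n,\Delta^{\preccurlyeq}$ infer $\Gamma,\Sigma^{\preccurlyeq}\Rightarrow A\preccurlyeq B,\Delta$. $\mathrm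 N^A_n$: from $\{\Gamma^{\preccurlyeq},\Sigma^{\preccurlyeq},C_k\Rightarrow D_1,\dots,D_{k-1},\Delta^{\preccurlyeq}\}_{k\le n}$ and $\Gamma^{\preccurlyeq},\Sigma^{\preccurlyeq}\Rightarrow D_1,\dots,D_n,\Delta^{\preccurlyeq}$ infer $\Gamma,\Sigma^{\preccurlyeq}\Rightarrow\Delta$. $\mathsf{G.N}=\{\mathrm{init},\bot_L,\to_L,\to_R\}\cup\{\mathrm{CP}_n\mid n\ge0\}$; $\mathsf{G.NN}=\mathsf{G.N}\cup\{\mathrm N_n\mid n\ge1\}$; $\mathsf{G.NT}=\mathsf{G.N}\cup\{\mathrm T_n\mid n\ge1\}$; $\mathsf{G.NW}=\mathsf{G.N}\cup\{\mathrm W_n\mid n\ge0\}\cup\{\mathrm T_n\mid n\ge1\}$; $\mathsf{G.NC}=\mathsf{G.N}\cup\{\mathrm W_0,\mathrm C_0\}$; $\mathsf{G.NA}=\{\mathrm{init},\bot_L,\to_L,\to_R\}\cup\{\mathrm A_n\mid n\ge0\}$; $\mathsf{G.NNA}=\mathsf{G.NA}\cup\{\mathrm N^A_n\mid n\ge1\}$. Hypersequent calculi. A block $[\Sigma\lhd A]$: finite multiset $\Sigma$ of formulas and formula $A$; a sequent with blocks $\Gamma\Rightarrow\Delta$: $\Gamma$ finite multiset of formulas, $\Delta$ finite multiset of formulas and blocks; a hypersequent: finite multiset $\Gamma_1\Rightarrow\Delta_1\mid\dots\mid\Gamma_n\Rightarrow\Delta_n$ of such. Rules ($\mathcal G$ =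 other components): init: $\mathcal G\mid\Gamma,p\Rightarrow p,\Delta$; $\bot_L$: $\mathcal G\mid\Gamma,\bot\Rightarrow\Delta$; $\to_L$: from $\mathcal G\mid\Gamma,A\to B,B\Rightarrow\Delta$ and $\mathcal G\mid\Gamma,A\to B\Rightarrow\Delta,A$ infer $\mathcal G\mid\Gamma,A\to B\Rightarrow\Delta$; $\to_R$: from $\mathcal G\mid\Gamma,A\Rightarrow\Delta,A\to B,B$ infer $\mathcal G\mid\Gamma\Rightarrow\Delta,A\to B$; $\preccurlyeq_L$: from $\mathcal G\mid\Gamma,A\preccurlyeq B\Rightarrow\Delta,[B,\Sigma\lhd C]$ and $\mathcal G\mid\Gamma,A\preccurlyeq B\Rightarrow\Delta,[\Sigma\lhd C],[\Sigma\lhd A]$ infer $\mathcal G\mid\Gamma,A\preccurlyeq B\Rightarrow\Delta,[\Sigma\lhd C]$; $\preccurlyeq_R$: from $\mathcal G\mid\Gamma\Rightarrow\Delta,A\preccurlyeq B,[A\lhd B]$ infer $\mathcal G\mid\Gamma\Rightarrow\Delta,A\preccurlyeq B$; jp: from $\mathcal G\mid\Gamma\Rightarrow\Delta,[\Sigma\lhd A]\mid A\Rightarrow\Sigma$ infer $\mathcal G\mid\Gamma\Rightarrow\Delta,[\Sigma\lhd A]$; N: from $\mathcal G\mid\Gamma\Rightarrow\Delta,[\bot\lhd\top]$ infer $\mathcal G\mid\Gamma\Rightarrow\Delta$; T: from $\mathcal G\mid\Gamma,A\preccurlyeq B\Rightarrow\Delta,B$ and $\mathcal G\mid\Gamma,A\preccurlyeq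 B\Rightarrow\Delta,[\bot\lhd A]$ infer $\mathcal G\mid\Gamma,A\preccurlyeq B\Rightarrow\Delta$; W: from $\mathcal G\mid\Gamma\Rightarrow\Delta,[\Sigma\lhd A],\Sigma$ infer $\mathcal G\mid\Gamma\Rightarrow\Delta,[\Sigma\lhd A]$; C: from $\mathcal G\mid\Gamma,A\preccurlyeq B\Rightarrow\Delta,B$ and $\mathcal G\mid\Gamma,A\preccurlyeq B,A\Rightarrow\Delta$ infer $\mathcal G\mid\Gamma,A\preccurlyeq B\Rightarrow\Delta$; $\mathrm A_L$: from $\mathcal G\mid\Gamma,A\preccurlyeq B\Rightarrow\Delta\mid\Omega,A\preccurlyeq B\Rightarrow\Theta$ infer $\mathcal G\mid\Gamma,A\preccurlyeq B\Rightarrow\Delta\mid\Omega\Rightarrow\Theta$; $\mathrm A_R$: from $\mathcal G\mid\Gamma\Rightarrow\Delta,A\preccurlyeq B\mid\Omega\Rightarrow\Theta,A\preccurlyeq B$ infer $\mathcal G\mid\Gamma\Rightarrow\Delta,A\preccurlyeq B\mid\Omega\Rightarrow\Theta$. $\mathsf{H.N}=\{\mathrm{init},\bot_L,\to_L,\to_R,\preccurlyeq_L,\preccurlyeq_R,\mathrm{jp}\}$; $\mathsf{H.NN}=\mathsf{H.N}+$N; $\mathsf{H.NT}=\mathsf{H.N}+$T; $\mathsf{H.NW}=\mathsf{H.N}+$T,W; $\mathsf{H.NC}=\mathsf{H.N}+$W,C; $\mathsf{H.NA}=\mathsf{H.N}+\mathrm A_L,\mathrm A_R$; $\mathsf{H.NNA}=\mathsf{H.NN}+\mathrm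 A_L,\mathrm A_R$. *)

(* Defs.v *)
From HB Require Import structures.
From mathcomp Require Import all_boot.
From mathcomp Require Import finmap multiset.

Set Implicit Arguments.
Unset Strict Implicit.
Unset Printing Implicit Defensive.

Local Open Scope mset_scope.
Local Open Scope nat_scope.

Inductive form : Type :=
| Atom of nat
| Bot
| Imp of form & form
| Cmp of form & form.

Declare Scope form_scope.
Delimit Scope form_scope with form.
Bind Scope form_scope with form.
Notation "A --> B" := (Imp A B)
  (at level 60, right associativity) : form_scope.
Notation "A ≼ B" := (Cmp A B)
  (at level 70, no associativity) : form_scope.
Local Open Scope form_scope.

Definition Top : form := Bot --> Bot.

(* A choiceType structure on formulas is needed to form multisets of them. *)
Fixpoint form_encode (A : form) : GenTree.tree nat :=
  match A with
  | Atom p => GenTree.Leaf p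
  | Bot => GenTree.Node 0 [::]
  | B --> C => GenTree.Node 1 [:: form_encode B; form_encode C]
  | B ≼ C => GenTree.Node 2 [:: form_encode B; form_encode C]
  end.

Fixpoint form_decode (t : GenTree.tree nat) : form :=
  match t with
  | GenTree.Leaf p => Atom p
  | GenTree.Node 1 [:: t1; t2] => form_decode t1 --> form_decode t2
  | GenTree.Node 2 [:: t1; t2] => form_decode t1 ≼ form_decode t2
  | GenTree.Node _ _ => Bot
  end.

Lemma form_encodeK : cancel form_encode form_decode.
Proof. by elim=> //= A -> B ->. Qed.

HB.instance Definition _ := Countable.copy form (can_type form_encodeK).

Definition is_cmp (A : form) : bool := if A is _ ≼ _ then true else false.

Definition cmps (G : {mset form}) : {mset form} :=
  seq_mset [seq A <- G | is_cmp A].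

(* Derivability from a set of rule instances, each given by its list of
   premises and its conclusion. *)
Inductive derivable (S : eqType) (rule : seq S -> S -> Prop) : S -> Prop :=
| Derive (ps : seq S) (c : S) :
    rule ps c -> (forall p, p \in ps -> derivable rule p) -> derivable rule c.

Inductive extension : Type := ExtE | ExtN | ExtT | ExtW | ExtC | ExtA | ExtNA.

Definition sequent : Type := ({mset form} * {mset form})%type.
HB.instance Definition _ := Choice.on sequent.

Definition mkSequent (G D : {mset form}) : sequent := (G, D).

Declare Scope sequent_scope.
Notation "G ⇒ D" := (mkSequent G%mset D%mset)
  (at level 70, no associativity) : sequent_scope.
Local Open Scope sequent_scope.

Inductive grule_name : Type :=
| G_init | G_botL | G_impL | G_impR
| G_CP of nat | G_N of nat | G_T of nat | G_W of nat | G_C0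
| G_A of nat | G_NA of nat.

(* The formulas C_1 ≼ D_1, ..., C_n ≼ D_n of an n-ary rule are indexed from 0:
   C_(k+1) and D_(k+1) are [C k] and [E k], where only the first n values of
   C, E : nat -> form matter.  [firsts E k] is the multiset D_1, ..., D_k, which
   occurs in the succedent of the premise for C_(k+1). *)
Definition firsts (E : nat -> form) (k : nat) : {mset form} :=
  seq_mset (mkseq E k).

Definition sigma (C E : nat -> form) (n : nat) : {mset form} :=
  seq_mset (mkseq (fun k => C k ≼ E k) n).

Implicit Types (A B : form) (G D S : {mset form}) (C E : nat -> form).

Inductive grule : grule_name -> seq sequent -> sequent -> Prop :=
| Grule_init G D p :
    grule G_init [::] (Atom p +` G ⇒ Atom p +` D)
| Grule_botL G D :
    grule G_botL [::] (Bot +` G ⇒ D)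
| Grule_impL G D A B :
    grule G_impL
      [:: G ⇒ A +` D;
          B +` G ⇒ D]
      ((A --> B) +` G ⇒ D)
| Grule_impR G D A B :
    grule G_impR
      [:: A +` G ⇒ B +` D]
      (G ⇒ (A --> B) +` D)
| Grule_CP n C E G D A B :
    grule (G_CP n)
      (rcons (mkseq (fun k => [mset C k] ⇒ A +` firsts E k) n)
             ([mset B] ⇒ A +` firsts E n))
      (G `+` sigma C E n ⇒ (A ≼ B) +` D)
| Grule_N n C E G D :
    grule (G_N n)
      (rcons (mkseq (fun k => [mset C k] ⇒ firsts E k) n)
             (mset0 ⇒ firsts E n))
      (G `+` sigma C E n ⇒ D)
| Grule_T n C E G D :
    grule (G_T n)
      (rcons (mkseq (fun k => [mset C k] ⇒ firsts E k) n)
             (G `+` sigma C E n ⇒ firsts E n `+` D))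
      (G `+` sigma C E n ⇒ D)
| Grule_W n C E G D A B :
    grule (G_W n)
      (rcons (mkseq (fun k => [mset C k] ⇒ A +` firsts E k) n)
             (G `+` sigma C E n ⇒ A +` ((A ≼ B) +` (firsts E n `+` D))))
      (G `+` sigma C E n ⇒ (A ≼ B) +` D)
| Grule_C0 G D A B :
    grule G_C0
      [:: A +` ((A ≼ B) +` G) ⇒ D;
          (A ≼ B) +` G ⇒ B +` D]
      ((A ≼ B) +` G ⇒ D)
| Grule_A n C E G D A B :
    grule (G_A n)
      (rcons
         (mkseq (fun k => C k +` (cmps G `+` sigma C E n) ⇒
                   (A ≼ B) +` (A +` (firsts E k `+` cmps D))) n)
         (B +` (cmps G `+` sigma C E n) ⇒
            (A ≼ B) +` (A +` (firsts E n `+` cmps D))))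
      (G `+` sigma C E n ⇒ (A ≼ B) +` D)
| Grule_NA n C E G D :
    grule (G_NA n)
      (rcons
         (mkseq (fun k => C k +` (cmps G `+` sigma C E n) ⇒
                   firsts E k `+` cmps D) n)
         (cmps G `+` sigma C E n ⇒ firsts E n `+` cmps D))
      (G `+` sigma C E n ⇒ D).

Definition gcalculus (X : extension) (r : grule_name) : bool :=
  match r with
  | G_init | G_botL | G_impL | G_impR => true
  | G_CP _ => match X with ExtA | ExtNA => false | _ => true end
  | G_N n => (0 < n) && (if X is ExtN then true else false)
  | G_T n => (0 < n) && (match X with ExtT | ExtW => true | _ => false end)
  | G_W n => match X with ExtW => true | ExtC => n == 0 | _ => false end
  | G_C0 => if X is ExtC then true else false
  | G_A _ => match X with ExtA | ExtNA => true | _ => false end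
  | G_NA n => (0 < n) && (if X is ExtNA then true else false)
  end.

Definition Gderivable (X : extension) : sequent -> Prop :=
  derivable (fun ps c => exists2 r, gcalculus X r & grule r ps c).

Definition block : Type := ({mset form} * form)%type.
HB.instance Definition _ := Choice.on block.

Definition mkBlock (S : {mset form}) (A : form) : block := (S, A).
Notation "S ◁ A" := (mkBlock S%mset A%form)
  (at level 70, no associativity) : sequent_scope.

(* The succedent, a finite multiset of formulas and blocks, is given as the pair
   of the multiset of its formulas and the multiset of its blocks. *)
Definition bsequent : Type :=
  ({mset form} * ({mset form} * {mset block}))%type.
HB.instance Definition _ := Choice.on bsequent.

Definition mkBSequent (G D : {mset form}) (K : {mset block}) : bsequent :=
  (G, (D, K)).
Notation "G ⇒ D ;; K" := (mkBSequent G%mset D%mset K%mset)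
  (at level 70, D at next level, K at next level, no associativity)
  : sequent_scope.

Definition hypersequent : Type := {mset bsequent}.
HB.instance Definition _ := Choice.on hypersequent.

Implicit Types (K : {mset block}) (H : hypersequent).

Inductive hrule_name : Type :=
| H_init | H_botL | H_impL | H_impR | H_cmpL | H_cmpR | H_jp
| H_N | H_T | H_W | H_C | H_AL | H_AR.

Inductive hrule : hrule_name -> seq hypersequent -> hypersequent -> Prop :=
| Hrule_init H G D K p :
    hrule H_init [::] ((Atom p +` G ⇒ Atom p +` D ;; K) +` H)
| Hrule_botL H G D K :
    hrule H_botL [::] ((Bot +` G ⇒ D ;; K) +` H)
| Hrule_impL H G D K A B :
    hrule H_impL
      [:: (B +` ((A --> B) +` G) ⇒ D ;; K) +` H;
          ((A --> B) +` G ⇒ A +` D ;; K) +` H]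
      (((A --> B) +` G ⇒ D ;; K) +` H)
| Hrule_impR H G D K A B :
    hrule H_impR
      [:: (A +` G ⇒ B +` ((A --> B) +` D) ;; K) +` H]
      ((G ⇒ (A --> B) +` D ;; K) +` H)
| Hrule_cmpL H G D K A B S (C : form) :
    hrule H_cmpL
      [:: ((A ≼ B) +` G ⇒ D ;; (B +` S ◁ C) +` K) +` H;
          ((A ≼ B) +` G ⇒ D ;; (S ◁ C) +` ((S ◁ A) +` K)) +` H]
      (((A ≼ B) +` G ⇒ D ;; (S ◁ C) +` K) +` H)
| Hrule_cmpR H G D K A B :
    hrule H_cmpR
      [:: (G ⇒ (A ≼ B) +` D ;; ([mset A] ◁ B) +` K) +` H]
      ((G ⇒ (A ≼ B) +` D ;; K) +` H)
| Hrule_jp H G D K S A :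
    hrule H_jp
      [:: (G ⇒ D ;; (S ◁ A) +` K) +` (([mset A] ⇒ S ;; mset0) +` H)]
      ((G ⇒ D ;; (S ◁ A) +` K) +` H)
| Hrule_N H G D K :
    hrule H_N
      [:: (G ⇒ D ;; ([mset Bot] ◁ Top) +` K) +` H]
      ((G ⇒ D ;; K) +` H)
| Hrule_T H G D K A B :
    hrule H_T
      [:: ((A ≼ B) +` G ⇒ B +` D ;; K) +` H;
          ((A ≼ B) +` G ⇒ D ;; ([mset Bot] ◁ A) +` K) +` H]
      (((A ≼ B) +` G ⇒ D ;; K) +` H)
| Hrule_W H G D K S A :
    hrule H_W
      [:: (G ⇒ S `+` D ;; (S ◁ A) +` K) +` H]
      ((G ⇒ D ;; (S ◁ A) +` K) +` H)
| Hrule_C H G D K A B :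
    hrule H_C
      [:: ((A ≼ B) +` G ⇒ B +` D ;; K) +` H;
          (A +` ((A ≼ B) +` G) ⇒ D ;; K) +` H]
      (((A ≼ B) +` G ⇒ D ;; K) +` H)
| Hrule_AL H G D K G' D' K' A B :
    hrule H_AL
      [:: ((A ≼ B) +` G ⇒ D ;; K) +` (((A ≼ B) +` G' ⇒ D' ;; K') +` H)]
      (((A ≼ B) +` G ⇒ D ;; K) +` ((G' ⇒ D' ;; K') +` H))
| Hrule_AR H G D K G' D' K' A B :
    hrule H_AR
      [:: (G ⇒ (A ≼ B) +` D ;; K) +` ((G' ⇒ (A ≼ B) +` D' ;; K') +` H)]
      ((G ⇒ (A ≼ B) +` D ;; K) +` ((G' ⇒ D' ;; K') +` H)).

Definition hcalculus (X : extension) (r : hrule_name) : bool :=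
  match r with
  | H_init | H_botL | H_impL | H_impR | H_cmpL | H_cmpR | H_jp => true
  | H_N => match X with ExtN | ExtNA => true | _ => false end
  | H_T => match X with ExtT | ExtW => true | _ => false end
  | H_W => match X with ExtW | ExtC => true | _ => false end
  | H_C => if X is ExtC then true else false
  | H_AL | H_AR => match X with ExtA | ExtNA => true | _ => false end
  end.

Definition Hderivable (X : extension) : hypersequent -> Prop :=
  derivable (fun ps c => exists2 r, hcalculus X r & hrule r ps c).

(* Main.v *)
Require Import Defs.
From mathcomp Require Import all_boot.
From mathcomp Require Import finmap multiset.

Set Implicit Arguments.
Unset Strict Implicit.
Unset Printing Implicit Defensive.

Local Open Scope mset_scope.
Local Open Scope sequent_scope.

(** Apart from the enlargement of blocks in [H_cmpL], the hypersequent rules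
    keep their principal formulas.  So derivability of [G ⇒ D] can be
    strengthened to derivability of every hypersequent with a component whose
    two sides contain [G] and [D] as sets; this absorbs weakening and
    contraction, and it is proved by a plain induction on the sequent
    derivation.  For the n-ary rules, a block [S ◁ B] is enlarged by [H_cmpL]
    with C_1 ≼ D_1, ..., C_n ≼ D_n in this order: the side branches carry the
    blocks [S, D_1, ..., D_(k-1) ◁ C_k] and the main branch ends with
    [S, D_1, ..., D_n ◁ B].  Jumping from these blocks yields the premises of
    the sequent rule. *)

Implicit Types (X : extension) (A B F : form) (G D S : {mset form}).
Implicit Types (C E : nat -> form) (K : {mset block}) (H : hypersequent).

(** * Inclusion of multisets read as sets *)

Lemma sub_mset1D (T : choiceType) (a : T) (U V : {mset T}) :
  {subset a +` U <= V} <-> a \in V /\ {subset U <= V}.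
Proof.
split=> [sUV | [aV sUV] x].
  by split=> [|x xU]; apply: sUV; rewrite in_mset1D ?eqxx ?xU ?orbT.
by rewrite in_mset1D => /orP[/eqP->|/sUV].
Qed.

Lemma sub_msetD (T : choiceType) (U U' V : {mset T}) :
  {subset U `+` U' <= V} <-> {subset U <= V} /\ {subset U' <= V}.
Proof.
split=> [sUV | [sUV sUV'] x].
  by split=> x xU; apply: sUV; rewrite in_msetD xU ?orbT.
by rewrite in_msetD => /orP[/sUV|/sUV'].
Qed.

Lemma sub_mset1 (T : choiceType) (a : T) (V : {mset T}) :
  {subset [mset a] <= V} <-> a \in V.
Proof.
split=> [sUV | aV x]; first by apply: sUV; rewrite in_mset1.
by rewrite in_mset1 => /eqP->.
Qed.

Lemma sub_mset1Dr (T : choiceType) (a : T) (U V : {mset T}) :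
  {subset U <= V} -> {subset U <= a +` V}.
Proof. by move=> sUV x /sUV; apply: mset1Dr. Qed.

Lemma sub_msetDl (T : choiceType) (U V : {mset T}) : {subset U <= U `+` V}.
Proof. by move=> x xU; rewrite in_msetD xU. Qed.

Lemma sub_msetDr (T : choiceType) (U V : {mset T}) : {subset V <= U `+` V}.
Proof. by move=> x xV; rewrite in_msetD xV orbT. Qed.

Lemma mem_seq_mset (T : choiceType) (s : seq T) : seq_mset s =i s.
Proof. by move=> x; apply: perm_mem; apply: perm_eq_seq_mset. Qed.

Lemma seq_mset_nil (T : choiceType) : seq_mset [::] = mset0 :> {mset T}.
Proof. by apply/msetP=> x; rewrite mset_seqE mset0E. Qed.

Lemma sub_firsts E k (V : {mset form}) :
  {subset firsts E k <= V} <-> forall i, i < k -> E i \in V.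
Proof.
split=> [sEV i lt_ik | EV x].
  by apply: sEV; rewrite mem_seq_mset map_f // mem_iota.
by rewrite mem_seq_mset => /mapP[i]; rewrite mem_iota => /andP[_ /EV] ? ->.
Qed.

Lemma mem_sigma C E n k G :
  {subset sigma C E n <= G} -> k < n -> (C k ≼ E k)%form \in G.
Proof.
move=> sG lt_kn; apply: sG; rewrite mem_seq_mset.
by apply: (map_f (fun k => (C k ≼ E k)%form)); rewrite mem_iota.
Qed.

Lemma mem_cmps F G : (F \in cmps G) = is_cmp F && (F \in G).
Proof. by rewrite mem_seq_mset mem_filter. Qed.

Lemma cmps_sub G G' : {subset G <= G'} -> {subset cmps G <= cmps G'}.
Proof. by move=> sG F; rewrite !mem_cmps => /andP[-> /sG]. Qed.

Lemma sigma_sub_cmps C E n G :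
  {subset sigma C E n <= G} -> {subset sigma C E n <= cmps G}.
Proof.
move=> sG F sF; rewrite mem_cmps sG // andbT.
by move: sF; rewrite mem_seq_mset => /mapP[k _ ->].
Qed.

(** * Hypersequent rules with principal formulas given by membership *)

Lemma Hderivable_rule X r ps c :
  hcalculus X r -> hrule r ps c -> {in ps, forall p, Hderivable X p} ->
  Hderivable X c.
Proof. by move=> Xr rc ?; apply: (@Derive _ _ ps) => //; exists r. Qed.

(** Membership of the principal formula suffices: [msetB1K] splits off one copy, and since the rule
    keeps it, the premises again concern all of [G]. The same argument serves [H_cmpR], [H_T] and
    [H_C]. *)
Lemma Hderivable_cmpL X H G D K A B S F :
  (A ≼ B)%form \in G ->
  Hderivable X ((G ⇒ D ;; (B +` S ◁ F) +` K) +` H) ->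
  Hderivable X ((G ⇒ D ;; (S ◁ F) +` ((S ◁ A) +` K)) +` H) ->
  Hderivable X ((G ⇒ D ;; (S ◁ F) +` K) +` H).
Proof.
move/msetB1K=> <- p1 p2; apply: Hderivable_rule (Hrule_cmpL _ _ _ _ _ _ _ _) _.
  by [].
by move=> p; rewrite !inE => /orP[] /eqP->.
Qed.

Lemma Hderivable_cmpR X H G D K A B :
  (A ≼ B)%form \in D ->
  Hderivable X ((G ⇒ D ;; ([mset A] ◁ B) +` K) +` H) ->
  Hderivable X ((G ⇒ D ;; K) +` H).
Proof.
move/msetB1K=> <- p1; apply: Hderivable_rule (Hrule_cmpR _ _ _ _ _ _) _ => //.
by move=> p; rewrite !inE => /eqP->.
Qed.

(** The new component is moved to the front, ready for the lemmas that act on the first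
    component. *)
Lemma Hderivable_jp X H G D K S A :
  Hderivable X (([mset A] ⇒ S ;; mset0) +` ((G ⇒ D ;; (S ◁ A) +` K) +` H)) ->
  Hderivable X ((G ⇒ D ;; (S ◁ A) +` K) +` H).
Proof.
move=> p1; apply: Hderivable_rule (Hrule_jp _ _ _ _ _ _) _ => //.
by move=> p; rewrite !inE => /eqP->; rewrite msetDCA.
Qed.

Lemma Hderivable_N X H G D K :
  hcalculus X H_N ->
  Hderivable X ((G ⇒ D ;; ([mset Bot] ◁ Top) +` K) +` H) ->
  Hderivable X ((G ⇒ D ;; K) +` H).
Proof.
move=> XN p1; apply: Hderivable_rule XN (Hrule_N _ _ _ _) _.
by move=> p; rewrite !inE => /eqP->.
Qed.

Lemma Hderivable_T X H G D K A B :
  hcalculus X H_T -> (A ≼ B)%form \in G ->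
  Hderivable X ((G ⇒ B +` D ;; K) +` H) ->
  Hderivable X ((G ⇒ D ;; ([mset Bot] ◁ A) +` K) +` H) ->
  Hderivable X ((G ⇒ D ;; K) +` H).
Proof.
move=> XT /msetB1K <- p1 p2; apply: Hderivable_rule XT (Hrule_T _ _ _ _ _ _) _.
by move=> p; rewrite !inE => /orP[] /eqP->.
Qed.

Lemma Hderivable_W X H G D K S A :
  hcalculus X H_W ->
  Hderivable X ((G ⇒ S `+` D ;; (S ◁ A) +` K) +` H) ->
  Hderivable X ((G ⇒ D ;; (S ◁ A) +` K) +` H).
Proof.
move=> XW p1; apply: Hderivable_rule XW (Hrule_W _ _ _ _ _ _) _.
by move=> p; rewrite !inE => /eqP->.
Qed.

Lemma Hderivable_C X H G D K A B :
  hcalculus X H_C -> (A ≼ B)%form \in G ->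
  Hderivable X ((G ⇒ B +` D ;; K) +` H) ->
  Hderivable X ((A +` G ⇒ D ;; K) +` H) ->
  Hderivable X ((G ⇒ D ;; K) +` H).
Proof.
move=> XC /msetB1K <- p1 p2; apply: Hderivable_rule XC (Hrule_C _ _ _ _ _ _) _.
by move=> p; rewrite !inE => /orP[] /eqP->.
Qed.

(** Each [H_AL] copies one comparison; induction on [L] copies them all into the first component.
    The second component never changes, so its comparisons stay available. *)
Lemma Hderivable_AL X H G D K G' D' K' L :
  hcalculus X H_AL -> {subset L <= cmps G} ->
  Hderivable X ((seq_mset L `+` G' ⇒ D' ;; K') +` ((G ⇒ D ;; K) +` H)) ->
  Hderivable X ((G' ⇒ D' ;; K') +` ((G ⇒ D ;; K) +` H)).
Proof.
move=> XA; elim: L G' => [|F L IHL] G' sL.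
  by rewrite seq_mset_nil mset0D.
rewrite mset_cons -msetDA (msetDCA [mset F]) => p1.
have: F \in cmps G by rewrite sL ?mem_head.
rewrite mem_cmps; case: F p1 sL => // A B p1 sL /= GAB.
rewrite msetDCA -(msetB1K GAB).
apply: Hderivable_rule XA (Hrule_AL _ _ _ _ _ _ _ _ _) _ => p.
rewrite !inE => /eqP->; rewrite msetDCA (msetB1K GAB).
by apply: IHL p1 => F LF; rewrite sL // inE LF orbT.
Qed.

(** The same iteration, with [H_AR] on the succedents. *)
Lemma Hderivable_AR X H G D K G' D' K' L :
  hcalculus X H_AR -> {subset L <= cmps D} ->
  Hderivable X ((G' ⇒ seq_mset L `+` D' ;; K') +` ((G ⇒ D ;; K) +` H)) ->
  Hderivable X ((G' ⇒ D' ;; K') +` ((G ⇒ D ;; K) +` H)).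
Proof.
move=> XA; elim: L D' => [|F L IHL] D' sL.
  by rewrite seq_mset_nil mset0D.
rewrite mset_cons -msetDA (msetDCA [mset F]) => p1.
have: F \in cmps D by rewrite sL ?mem_head.
rewrite mem_cmps; case: F p1 sL => // A B p1 sL /= DAB.
rewrite msetDCA -(msetB1K DAB).
apply: Hderivable_rule XA (Hrule_AR _ _ _ _ _ _ _ _ _) _ => p.
rewrite !inE => /eqP->; rewrite msetDCA (msetB1K DAB).
by apply: IHL p1 => F LF; rewrite sL // inE LF orbT.
Qed.

(** * Strengthened derivability and the n-ary rules *)

(** With [H] arbitrary, an induction hypothesis can be used at the component created by a jump, the
    rest of the hypersequent serving as [H]. *)
Definition Hentails X G D : Prop :=
  forall G' D' K H, {subset G <= G'} -> {subset D <= D'} ->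
    Hderivable X ((G' ⇒ D' ;; K) +` H).

Lemma Hentails_jp X G0 D0 H G D K S A :
  Hentails X G0 D0 -> {subset G0 <= [mset A]} -> {subset D0 <= S} ->
  Hderivable X ((G ⇒ D ;; (S ◁ A) +` K) +` H).
Proof. by move=> e0 sG0 sD0; apply: Hderivable_jp; apply: e0. Qed.

(** After the jump, all comparisons of the parent are copied into the new component; they supply the
    contexts retained in the premises of [Grule_A] and [Grule_NA]. *)
Lemma Hentails_jpA X G0 D0 H G D K S A :
  hcalculus X H_AL -> hcalculus X H_AR -> Hentails X G0 D0 ->
  {subset G0 <= A +` cmps G} -> {subset D0 <= S `+` cmps D} ->
  Hderivable X ((G ⇒ D ;; (S ◁ A) +` K) +` H).
Proof.
move=> XAL XAR e0 sG0 sD0; apply: Hderivable_jp.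
apply: (@Hderivable_AL _ _ _ _ _ _ _ _ (cmps G)) => //.
apply: (@Hderivable_AR _ _ _ _ _ _ _ _ (cmps D)) => //.
by rewrite !seq_mset_id; apply: e0; rewrite msetDC.
Qed.

(** Iterates [H_cmpL], the last pair being treated topmost. How the resulting blocks are closed is
    left to the hypotheses, so that one induction serves plain jumps, jumps with copying, and
    [H_W]. *)
Lemma Hderivable_block X H G D C E n S B K :
  {subset sigma C E n <= G} ->
  (forall k S' K', k < n -> {subset S <= S'} -> {subset firsts E k <= S'} ->
     Hderivable X ((G ⇒ D ;; (S' ◁ C k) +` K') +` H)) ->
  (forall S' K', {subset S <= S'} -> {subset firsts E n <= S'} ->
     Hderivable X ((G ⇒ D ;; (S' ◁ B) +` K') +` H)) ->
  Hderivable X ((G ⇒ D ;; (S ◁ B) +` K) +` H).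
Proof.
move/mem_sigma; elim: n K => [|n IHn] K GCE side main.
  by apply: main => //; apply/sub_firsts.
apply: IHn => [k /ltnW/GCE //|k S' K' /ltnW|S' K' sS sE]; first exact: side.
(* Indices start at 0: adding [E n] to the block completes [firsts E n.+1], while the side block for
   [C n] needs only [firsts E n]. *)
apply: (Hderivable_cmpL (GCE n _)) => //.
  apply: main; first exact: sub_mset1Dr.
  apply/sub_firsts=> i; rewrite ltnS leq_eqVlt => /orP[/eqP->|lt_in].
    exact: mset1D1.
  by apply: mset1Dr; apply: (proj1 (sub_firsts _ _ _) sE).
by rewrite msetDCA; apply: side.
Qed.

(** Each of [n] uses of [H_T] adds one [E k] to the succedent. Its other branch opens the block
    [[mset Bot] ◁ C k], which is enlarged with the earlier pairs; the extra [Bot] is absorbed as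
    weakening. *)
Lemma Hentails_T X H G D C E n K :
  hcalculus X H_T -> {subset sigma C E n <= G} ->
  (forall k, k < n -> Hentails X [mset C k] (firsts E k)) ->
  (forall D', {subset D <= D'} -> {subset firsts E n <= D'} ->
     Hderivable X ((G ⇒ D' ;; K) +` H)) ->
  Hderivable X ((G ⇒ D ;; K) +` H).
Proof.
move=> XT /mem_sigma; elim: n => [|n IHn] GCE side main.
  by apply: main => //; apply/sub_firsts.
apply: IHn => [k /ltnW/GCE //|k /ltnW|D' sD sE]; first exact: side.
apply: (Hderivable_T XT (GCE n _)) => //.
  apply: main; first exact: sub_mset1Dr.
  apply/sub_firsts=> i; rewrite ltnS leq_eqVlt => /orP[/eqP->|lt_in].
    exact: mset1D1.
  by apply: mset1Dr; apply: (proj1 (sub_firsts _ _ _) sE).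
(* Only the pairs before [n] enlarge the block, so its main branch jumps to the premise for
   [C n]. *)
apply: (@Hderivable_block _ _ _ _ C E n).
- move=> F; rewrite mem_seq_mset => /mapP[k].
  rewrite mem_iota => /andP[_ lt_kn] ->.
  exact/GCE/ltnW.
- by move=> k S' K' /ltnW/side e _ sE'; apply: Hentails_jp e _ _.
- by move=> S' K' _ sE'; apply: Hentails_jp (side n _) _ _.
Qed.

Lemma mem_rcons_mkseq (T : eqType) (f : nat -> T) n x (P : T -> Prop) :
  {in rcons (mkseq f n) x, forall p, P p} ->
  (forall k, k < n -> P (f k)) /\ P x.
Proof.
move=> Pf; split=> [k lt_kn|]; apply: Pf; rewrite mem_rcons inE ?eqxx //.
by rewrite map_f ?orbT // mem_iota.
Qed.

(** * Translation of the sequent rules *)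

Lemma Gderivable_Hentails X (s : sequent) :
  Gderivable X s -> Hentails X s.1 s.2.
Proof.
elim=> {s} ps c [r Xr rc] _.
case: r ps c / rc Xr => /=.
- move=> G D p _ _ G' D' K H /sub_mset1D[Gp _] /sub_mset1D[Dp _].
  rewrite -(msetB1K Gp) -(msetB1K Dp).
  by apply: Hderivable_rule (Hrule_init _ _ _ _ _) _.
- move=> G D _ _ G' D' K H /sub_mset1D[Gp _] _.
  by rewrite -(msetB1K Gp); apply: Hderivable_rule (Hrule_botL _ _ _ _) _.
- move=> G D A B _ IH G' D' K H /sub_mset1D[GAB sG] sD.
  rewrite -(msetB1K GAB); apply: Hderivable_rule (Hrule_impL _ _ _ _ _ _) _ => //.
  (* As [A --> B] is kept, the antecedent folds back to [G'] and the induction hypotheses apply. *)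
  rewrite (msetB1K GAB) => p; rewrite !inE => /orP[] /eqP->.
    apply: (IH (B +` G ⇒ D)); rewrite ?inE ?eqxx ?orbT //=.
    by apply/sub_mset1D; split; [apply: mset1D1 | apply: sub_mset1Dr].
  apply: (IH (G ⇒ A +` D)); rewrite ?inE ?eqxx //=.
  by apply/sub_mset1D; split; [apply: mset1D1 | apply: sub_mset1Dr].
- move=> G D A B _ IH G' D' K H sG /sub_mset1D[DAB sD].
  rewrite -(msetB1K DAB); apply: Hderivable_rule (Hrule_impR _ _ _ _ _ _) _ => //.
  rewrite (msetB1K DAB) => p; rewrite !inE => /eqP->.
  apply: (IH (A +` G ⇒ B +` D)); rewrite ?inE ?eqxx //=;
    by apply/sub_mset1D; split; [apply: mset1D1 | apply: sub_mset1Dr].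
- move=> n C E G D A B _ /mem_rcons_mkseq[/= IHC IHB] G' D' K H.
  move=> /sub_msetD[sG sGE] /sub_mset1D[DAB sD].
  (* The block opened is [[mset A] ◁ B]; it supplies the [A] in the succedent of every premise. *)
  apply: (Hderivable_cmpR DAB); apply: Hderivable_block sGE _ _.
    move=> k S' K' /IHC e /sub_mset1 AS sE.
    by apply: Hentails_jp e _ _ => //; apply/sub_mset1D.
  move=> S' K' /sub_mset1 AS sE.
  by apply: Hentails_jp IHB _ _ => //; apply/sub_mset1D.
- move=> n C E G D /andP[_ XN] /mem_rcons_mkseq[/= IHC IHB] G' D' K H.
  move=> /sub_msetD[sG sGE] sD.
  apply: Hderivable_N; first by move: XN; case: (X).
  apply: Hderivable_block sGE _ _ => [k S' K' /IHC e _ sE|S' K' _ sE].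
    exact: Hentails_jp e _ _.
  (* The last premise has an empty antecedent; the [Top] brought in by the jump is weakening. *)
  by apply: Hentails_jp IHB _ _ => // x; rewrite in_mset0.
- move=> n C E G D /andP[_ XT] /mem_rcons_mkseq[/= IHC IHB] G' D' K H.
  move=> sG sD; have [_ sGE] := (sub_msetD _ _ _).1 sG.
  apply: Hentails_T sGE IHC _; first by move: XT; case: (X).
  move=> D'' sD'' sE; apply: IHB => //; apply/sub_msetD; split=> // x /sD.
  exact: sD''.
- move=> n C E G D A B XW /mem_rcons_mkseq[/= IHC IHB] G' D' K H.
  move=> sG sD; have [_ sGE] := (sub_msetD _ _ _).1 sG.
  have [DAB sD0] := (sub_mset1D _ _ _).1 sD.
  apply: (Hderivable_cmpR DAB); apply: Hderivable_block sGE _ _.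
    move=> k S' K' /IHC e /sub_mset1 AS sE.
    by apply: Hentails_jp e _ _ => //; apply/sub_mset1D.
  move=> S' K' /sub_mset1 AS sE.
  (* Instead of a jump, [H_W] copies the enlarged block, containing [A] and [firsts E n], into the
     succedent, which gives the last premise. The case [n = 0] is covered as well. *)
  apply: Hderivable_W; first by move: XW; case: (X).
  apply: IHB => //; apply/sub_mset1D; rewrite in_msetD AS; split=> //.
  apply/sub_mset1D; rewrite in_msetD DAB orbT; split=> //.
  apply/sub_msetD; split=> x => [/sE|/sD0]; first exact: sub_msetDl.
  exact: sub_msetDr.
- move=> G D A B XC IH G' D' K H sG sD.
  have [GAB _] := (sub_mset1D _ _ _).1 sG.
  apply: (Hderivable_C _ GAB); first by move: XC; case: (X).
    apply: (IH ((A ≼ B)%form +` G ⇒ B +` D)); rewrite ?inE ?eqxx ?orbT //=.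
    by apply/sub_mset1D; split; [apply: mset1D1 | apply: sub_mset1Dr].
  apply: (IH (A +` ((A ≼ B)%form +` G) ⇒ D)); rewrite ?inE ?eqxx ?orbT //=.
  by apply/sub_mset1D; split; [apply: mset1D1 | apply: sub_mset1Dr].
- move=> n C E G D A B XA /mem_rcons_mkseq[/= IHC IHB] G' D' K H.
  move=> /sub_msetD[sG sGE] /sub_mset1D[DAB sD].
  have ante B' : {subset B' +` (cmps G `+` sigma C E n) <= B' +` cmps G'}.
    apply/sub_mset1D; split; first exact: mset1D1.
    apply/sub_mset1Dr/sub_msetD; split; first exact: cmps_sub.
    exact: sigma_sub_cmps.
  (* [A ≼ B] is found among the comparisons copied from [D']; [A] and [firsts E k] come from the
     block. *)
  have succ S' k : {subset [mset A] <= S'} -> {subset firsts E k <= S'} ->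
      {subset (A ≼ B)%form +` (A +` (firsts E k `+` cmps D)) <= S' `+` cmps D'}.
    move=> /sub_mset1 AS sE; apply/sub_mset1D; split.
      by rewrite in_msetD mem_cmps DAB orbT.
    apply/sub_mset1D; split; first by rewrite in_msetD AS.
    apply/sub_msetD; split=> x => [/sE|/(cmps_sub sD)]; first exact: sub_msetDl.
    exact: sub_msetDr.
  apply: (Hderivable_cmpR DAB); apply: Hderivable_block sGE _ _.
    move=> k S' K' /IHC e AS sE.
    by apply: Hentails_jpA e (ante _) (succ _ _ AS sE); move: XA; case: (X).
  move=> S' K' AS sE.
  by apply: Hentails_jpA IHB (ante _) (succ _ _ AS sE); move: XA; case: (X).
- move=> n C E G D /andP[_ XA] /mem_rcons_mkseq[/= IHC IHB] G' D' K H.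
  move=> /sub_msetD[sG sGE] sD.
  have ante : {subset cmps G `+` sigma C E n <= cmps G'}.
    apply/sub_msetD; split; first exact: cmps_sub.
    exact: sigma_sub_cmps.
  have succ S' k : {subset firsts E k <= S'} ->
      {subset firsts E k `+` cmps D <= S' `+` cmps D'}.
    move=> sE; apply/sub_msetD.
    split=> x => [/sE|/(cmps_sub sD)]; first exact: sub_msetDl.
    exact: sub_msetDr.
  (* As for [G_N], a block [[mset Bot] ◁ Top] is opened, now closed by jumps that also copy
     comparisons. *)
  apply: Hderivable_N; first by move: XA; case: (X).
  apply: Hderivable_block sGE _ _ => [k S' K' /IHC e _ sE|S' K' _ sE].
    apply: Hentails_jpA e _ (succ _ _ sE); try by move: XA; case: (X).
    by apply/sub_mset1D; split; [apply: mset1D1 | apply: sub_mset1Dr].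
  apply: Hentails_jpA IHB _ (succ _ _ sE); try by move: XA; case: (X).
  exact: sub_mset1Dr.
Qed.

Theorem theorem5p4 (X : extension) (A : form) :
  Gderivable X (mset0 ⇒ [mset A]) ->
  Hderivable X [mset (mset0 ⇒ [mset A] ;; mset0)].
Proof.
move/Gderivable_Hentails => /(_ mset0 [mset A] mset0 mset0).
by rewrite msetD0; apply.
Qed.
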